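(* There exists a Jónsson–Tarski algebra with universe $\omega_1$ which is a Jónsson algebra.
   Context: A Jónsson–Tarski algebra is an algebra $\langle A;\cdot,\ell,r\rangle$ with a binary operation $\cdot$ and unary operations $\ell,r$ satisfying the identities $\ell(x\cdot y)=x$, $r(x\cdot y)=y$, $\ell(z)\cdot r(z)=z$. A Jónsson algebra is an infinite algebra in a countable algebraic language which has no proper subalgebra of the same cardinality as itself. *)

(* Defs.v *)
From mathcomp Require Import all_boot.
From mathcomp Require Import all_classical.
From mathcomp Require Import wochoice.

Set Implicit Arguments.
Unset Strict Implicit.
Unset Printing Implicit Defensive.

Local Open Scope classical_set_scope.
Local Open Scope card_scope.

Record signature := Signature {
  operation : Type;
  arity : operation -> nat }.

Definition countable_signature (S : signature) :=
  countable [set: operation S].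

Definition algebra (S : signature) (A : Type) :=
  forall o : operation S, (arity o).-tuple A -> A.

(* Subalgebras are identified with their universes. The empty set is allowed
   when there are no constants; this is immaterial in [jonsson_algebra]. *)
Definition subalgebra (S : signature) (A : Type) (I : algebra S A)
    (B : set A) :=
  forall (o : operation S) (t : (arity o).-tuple A),
    (forall i, B (tnth t i)) -> B (I o t).

Definition jonsson_algebra (S : signature) (A : Type) (I : algebra S A) :=
  [/\ countable_signature S,
      infinite_set [set: A]
    & ~ exists B : set A,
        [/\ subalgebra I B, B `<` [set: A] & B #= [set: A]]].

Variant jt_operation := JTmul | JTl | JTr.

Definition jt_arity (o : jt_operation) : nat :=
  match o with JTmul => 2 | JTl | JTr => 1 end.

Definition jt_signature := Signature jt_arity.

Definition jt_algebra (A : Type) (mul : A -> A -> A) (l r : A -> A) :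
    algebra jt_signature A :=
  fun o => match o return (jt_arity o).-tuple A -> A with
  | JTmul => fun t => mul (tnth t ord0) (tnth t ord_max)
  | JTl => fun t => l (thead t)
  | JTr => fun t => r (thead t)
  end.

Definition jonsson_tarski (A : Type) (mul : A -> A -> A) (l r : A -> A) :=
  [/\ forall x y, l (mul x y) = x,
      forall x y, r (mul x y) = y
    & forall z, mul (l z) (r z) = z].

(* omega_1 is realised as the set of countable ordinals, a countable ordinal
   being an isomorphism class of well-orders on subsets of [nat]; the values of
   [cwo_le] outside [cwo_dom] are irrelevant. The theorems [omega1_well_order],
   [countable_omega1_lt] and [uncountable_omega1] below characterise omega_1 up
   to order isomorphism. *)
Record cwo := Cwo {
  cwo_dom : {pred nat};
  cwo_le : rel nat;
  cwo_wf : wo_chain cwo_le cwo_dom }.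

Definition cwo_iso (a b : cwo) :=
  exists f : nat -> nat,
    set_bij [set` cwo_dom a] [set` cwo_dom b] f /\
    {in cwo_dom a &, {mono f : x y / cwo_le a x y >-> cwo_le b x y}}.

Definition order_type (a : cwo) : set cwo := [set b | cwo_iso a b].

Definition omega1 : Type := {C : set cwo | range order_type C}.

Definition cwo_seg_dom (a : cwo) (x : nat) : {pred nat} :=
  [pred y in cwo_dom a | ~~ cwo_le a x y].

Lemma cwo_seg_wf a x : wo_chain (cwo_le a) (cwo_seg_dom a x).
Proof.
move=> A sA; apply: (cwo_wf (c := a)) => y /sA.
by rewrite inE => /andP[].
Qed.

Definition cwo_seg (a : cwo) (x : nat) : cwo := Cwo (cwo_seg_wf (a := a) (x := x)).

Definition omega1_lt (alpha beta : omega1) :=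
  exists a b, [/\ sval alpha a, sval beta b &
    exists2 y, y \in cwo_dom b & cwo_iso a (cwo_seg b y)].

Definition omega1_le : rel omega1 :=
  fun alpha beta => `[< alpha = beta \/ omega1_lt alpha beta >].

Definition isof (a b : cwo) (f : nat -> nat) :=
  [/\ {in cwo_dom a, forall x, f x \in cwo_dom b},
      {in cwo_dom a &, forall x y, cwo_le b (f x) (f y) = cwo_le a x y} &
      {in cwo_dom b, forall y, exists2 x, x \in cwo_dom a & f x = y}].

Lemma cwo_refl a : {in cwo_dom a, forall x, cwo_le a x x}.
Proof. exact: wo_chain_reflexive (@cwo_wf a). Qed.

Lemma cwo_anti a : {in cwo_dom a &, forall x y,
  cwo_le a x y -> cwo_le a y x -> x = y}.
Proof.
move=> x y xa ya xy yx; apply: (wo_chain_antisymmetric (@cwo_wf a)) => //.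
by rewrite xy yx.
Qed.

Lemma cwo_total a : {in cwo_dom a &, forall x y, cwo_le a x y || cwo_le a y x}.
Proof. exact: wo_chainW (@cwo_wf a). Qed.

Lemma cwo_min a (P : nat -> Prop) x : x \in cwo_dom a -> P x ->
  exists z, [/\ z \in cwo_dom a, P z &
    forall y, y \in cwo_dom a -> P y -> cwo_le a z y].
Proof.
move=> xa Px; pose A : {pred nat} := [pred y in cwo_dom a | `[< P y >]].
have sA : {subset A <= cwo_dom a} by move=> y; rewrite inE => /andP[].
have [|z [[]]] := cwo_wf sA.
  by exists x; rewrite inE xa; apply/asboolP.
rewrite inE => /andP[za /asboolP Pz] zmin _; exists z; split => // y ya Py.
by apply: zmin; rewrite inE ya; apply/asboolP.
Qed.

Lemma cwo_trans a : {in cwo_dom a & &, forall x y z,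
  cwo_le a x y -> cwo_le a y z -> cwo_le a x z}.
Proof.
move=> x y z xa ya za xy yz.
have [m [ma Pm mmin]] := @cwo_min a (fun t => t = x \/ t = y \/ t = z) x xa
  (or_introl erefl).
have mx := mmin x xa (or_introl erefl).
have my := mmin y ya (or_intror (or_introl erefl)).
have mz := mmin z za (or_intror (or_intror erefl)).
case: Pm => [mE|[mE|mE]]; subst m => //.
  by rewrite (cwo_anti xa ya xy mx).
by rewrite -(cwo_anti ya za yz my).
Qed.

Lemma isofP a b : cwo_iso a b <-> exists f, isof a b f.
Proof.
split=> [[f [[fsub finj fsurj] fmono]]|[f [fsub fmono fsurj]]]; exists f.
  split => [x xa|x y xa ya|y /fsurj[x xa <-]]; last by exists x.
  - exact: fsub.
  - exact: fmono.
split; last by move=> x y xa ya; exact: fmono.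
split=> [x xa|x y|y /fsurj[x xa <-]]; last by exists x.
- exact: fsub.
- rewrite !inE => xa ya fxy.
  have := fmono x y xa ya; have := fmono y x ya xa.
  rewrite fxy (cwo_refl (fsub _ ya)) => /esym yx /esym xy.
  exact: (cwo_anti xa ya).
Qed.

Lemma isof_inj a b f : isof a b f -> {in cwo_dom a &, injective f}.
Proof.
move=> [fsub fmono fsurj] x y xa ya fxy.
have := fmono x y xa ya; have := fmono y x ya xa.
rewrite fxy (cwo_refl (fsub _ ya)) => /esym yx /esym xy.
exact: (cwo_anti xa ya).
Qed.

Lemma iso_refl a : cwo_iso a a.
Proof. by apply/isofP; exists id; split=> // y ya; exists y. Qed.

Lemma iso_trans b a c : cwo_iso a b -> cwo_iso b c -> cwo_iso a c.
Proof.
move=> /isofP[f [f1 f2 f3]] /isofP[g [g1 g2 g3]]; apply/isofP.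
exists (g \o f); split=> [x xa|x y xa ya|z zc] /=.
- by apply/g1/f1.
- by rewrite g2 ?f1 ?f2.
- have [y yb <-] := g3 z zc; have [x xa <-] := f3 y yb.
  by exists x.
Qed.

Lemma iso_sym a b : cwo_iso a b -> cwo_iso b a.
Proof.
move=> /isofP[f [f1 f2 f3]]; apply/isofP.
have /choice[g gP] : forall y, exists x, y \in cwo_dom b ->
    x \in cwo_dom a /\ f x = y.
  move=> y; have [/f3[x xa fx]|_] := boolP (y \in cwo_dom b).
    by exists x.
  by exists 0.
have fi := isof_inj (And3 f1 f2 f3).
exists g; split=> [y yb|x y xb yb|x xa].
- by have [] := gP y yb.
- have [ga fg] := gP x xb; have [ga' fg'] := gP y yb.
  by rewrite -f2 // fg fg'.
- have [ga fg] := gP (f x) (f1 x xa).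
  by exists (f x); [exact: f1 | apply: fi].
Qed.

Lemma segP a x y : reflect (y \in cwo_dom a /\ ~~ cwo_le a x y)
  (y \in cwo_dom (cwo_seg a x)).
Proof. by rewrite /= /cwo_seg_dom inE /=; exact: andP. Qed.

Lemma cwo_ltW a : {in cwo_dom a &, forall x y, ~~ cwo_le a x y -> cwo_le a y x}.
Proof. by move=> x y xa ya xy; have := cwo_total xa ya; rewrite (negPf xy). Qed.

Lemma isof_seg a b f x : isof a b f -> x \in cwo_dom a ->
  cwo_iso (cwo_seg a x) (cwo_seg b (f x)).
Proof.
move=> [f1 f2 f3] xa; apply/isofP; exists f; split.
- by move=> y /segP[ya yx]; apply/segP; split; [exact: f1|rewrite f2].
- by move=> y z /segP[ya yx] /segP[za zx]; rewrite /= f2.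
- move=> y /segP[yb yx]; have [z za fz] := f3 y yb; exists z => //.
  by apply/segP; split => //; rewrite -f2 // fz.
Qed.

Lemma seg_seg a x y : x \in cwo_dom a -> y \in cwo_dom (cwo_seg a x) ->
  cwo_iso (cwo_seg (cwo_seg a x) y) (cwo_seg a y).
Proof.
move=> xa /segP[ya yx]; apply/isofP; exists id; split=> //.
  by move=> z /segP[/segP[za zx] zy]; apply/segP.
move=> z /segP[za zy]; exists z => //; apply/segP; split=> //; apply/segP.
split => //; apply: contra yx => xz; apply: (cwo_trans xa za ya) => //.
exact: cwo_ltW.
Qed.

Lemma seg_not_iso a x : x \in cwo_dom a -> ~ cwo_iso a (cwo_seg a x).
Proof.
move=> xa /isofP[f [f1 f2 f3]].
have fa z : z \in cwo_dom a -> f z \in cwo_dom a by move=> /f1/segP[].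
have /segP[_ fxx] := f1 x xa.
have [m [ma mP mmin]] := @cwo_min a (fun z => ~~ cwo_le a z (f z)) x xa fxx.
have := mmin (f m) (fa _ ma); rewrite (negPf mP) => abs.
by suff: false by []; apply: abs; have /= -> := f2 m (f m) ma (fa _ ma).
Qed.

Lemma seg_inj a x y : x \in cwo_dom a -> y \in cwo_dom a ->
  cwo_iso (cwo_seg a x) (cwo_seg a y) -> x = y.
Proof.
wlog xy : x y / cwo_le a x y.
  move=> IH xa ya xy; have /orP[/IH|/IH] := cwo_total xa ya; first exact.
  by move=> H; apply/esym/H => //; exact: iso_sym.
move=> xa ya /iso_sym i; apply: contrapT => nxy.
have xs : x \in cwo_dom (cwo_seg a y).
  by apply/segP; split=> //; apply/negP => yx; apply: nxy; apply: (cwo_anti xa ya).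
apply: (seg_not_iso xs); apply: iso_trans i _.
by apply/iso_sym/seg_seg.
Qed.

Lemma cwo_compare a b : cwo_iso a b \/
  (exists2 y, y \in cwo_dom b & cwo_iso a (cwo_seg b y)) \/
  (exists2 x, x \in cwo_dom a & cwo_iso (cwo_seg a x) b).
Proof.
pose G x y := [/\ x \in cwo_dom a, y \in cwo_dom b &
  cwo_iso (cwo_seg a x) (cwo_seg b y)].
have Gle x y x' y' : G x y -> G x' y' -> cwo_le a x x' = cwo_le b y y'.
  move=> [xa yb i] [xa' yb' i'].
  have key c d u v u' v' : u \in cwo_dom c -> u' \in cwo_dom c ->
      v \in cwo_dom d -> v' \in cwo_dom d ->
      cwo_iso (cwo_seg c u) (cwo_seg d v) ->
      cwo_iso (cwo_seg c u') (cwo_seg d v') -> ~~ cwo_le c u u' -> ~~ cwo_le d v v'.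
    move=> uc uc' vd vd' j j' lt.
    have /isofP[f jf] := j; have us : u' \in cwo_dom (cwo_seg c u) by apply/segP.
    have /segP[fd fv] : f u' \in cwo_dom (cwo_seg d v) by case: jf => + _ _; apply.
    suff -> : v' = f u' by [].
    apply: (@seg_inj d) => //; apply: iso_trans (iso_sym j') _.
    apply: iso_trans (iso_sym (seg_seg uc us)) _.
    apply: iso_trans (isof_seg jf us) _.
    by apply: seg_seg => //; apply/segP.
  apply/idP/idP; apply: contraLR.
    exact: (key b a) (iso_sym i) (iso_sym i').
  exact: (key a b) i i'.
have Gdown x y x' : G x y -> x' \in cwo_dom (cwo_seg a x) -> exists y', G x' y'.
  move=> [xa yb /isofP[f jf]] x's; exists (f x').
  have fs : f x' \in cwo_dom (cwo_seg b y) by case: jf => + _ _; apply.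
  split; [by case/segP: x's|by case/segP: fs|].
  apply: iso_trans (iso_sym (seg_seg xa x's)) _.
  by apply: iso_trans (isof_seg jf x's) _; apply: seg_seg.
have Gdown' x y y' : G x y -> y' \in cwo_dom (cwo_seg b y) -> exists x', G x' y'.
  move=> [xa yb /iso_sym/isofP[f jf]] x's; exists (f y').
  have fs : f y' \in cwo_dom (cwo_seg a x) by case: jf => + _ _; apply.
  split; [by case/segP: fs|by case/segP: x's|].
  apply: iso_sym.
  apply: iso_trans (iso_sym (seg_seg yb x's)) _.
  by apply: iso_trans (isof_seg jf x's) _; apply: seg_seg.
have [Da|Da] := pselect (forall x, x \in cwo_dom a -> exists y, G x y);
have [Db|Db] := pselect (forall y, y \in cwo_dom b -> exists x, G x y).
- left; apply/isofP.
  have /choice[f fP] : forall x, exists y, x \in cwo_dom a -> G x y.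
    move=> x; have [/Da[y Gxy]|_] := boolP (x \in cwo_dom a); first by exists y.
    by exists 0.
  exists f; split=> [x /fP[]//|x y /fP+ /fP|y /Db[x Gxy]].
    by move=> ? ?; apply/esym/Gle.
  have [xa yb i] := Gxy; exists x => //; have [_ fb j] := fP x xa.
  by apply: (@seg_inj b) => //; apply: iso_trans (iso_sym j) i.
- right; left; move/existsNP: Db => [y0 /not_implyP[yb nG]].
  have [m [mb nGm mmin]] := @cwo_min b (fun y => ~ exists x, G x y) y0 yb nG.
  exists m => //; apply/isofP.
  have /choice[f fP] : forall x, exists y, x \in cwo_dom a -> G x y.
    move=> x; have [/Da[y Gxy]|_] := boolP (x \in cwo_dom a); first by exists y.
    by exists 0.
  exists f; split=> [x xa|x y /fP+ /fP|y /segP[yb' ym]].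
  + have Gx := fP x xa; have [_ fb j] := Gx; apply/segP; split=> //.
    apply/negP => mf; apply: (nGm); have [->|nm] := eqVneq m (f x); first by exists x.
    apply: (Gdown' _ _ _ Gx); apply/segP; split => //.
    by apply: contra nm => fm; apply/eqP; apply: (cwo_anti mb fb).
  + by move=> ? ?; apply/esym/Gle.
  + have [x Gx] : exists x, G x y.
      by apply: contrapT => /(mmin _ yb'); rewrite (negPf ym).
    have [xa _ i] := Gx; exists x => //; have [_ fb j] := fP x xa.
    by apply: (@seg_inj b) => //; apply: iso_trans (iso_sym j) i.
- right; right; move/existsNP: Da => [x0 /not_implyP[xa nG]].
  have [m [ma nGm mmin]] := @cwo_min a (fun x => ~ exists y, G x y) x0 xa nG.
  exists m => //; apply/iso_sym/isofP.
  have /choice[f fP] : forall y, exists x, y \in cwo_dom b -> G x y.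
    move=> y; have [/Db[x Gxy]|_] := boolP (y \in cwo_dom b); first by exists x.
    by exists 0.
  exists f; split=> [y yb|x y /fP+ /fP|x /segP[xa' xm]].
  + have Gx := fP y yb; have [fa _ j] := Gx; apply/segP; split=> //.
    apply/negP => mf; apply: (nGm); have [->|nm] := eqVneq m (f y); first by exists y.
    apply: (Gdown _ _ _ Gx); apply/segP; split => //.
    by apply: contra nm => fm; apply/eqP; apply: (cwo_anti ma fa).
  + by move=> ? ?; apply/Gle.
  + have [y Gx] : exists y, G x y.
      by apply: contrapT => /(mmin _ xa'); rewrite (negPf xm).
    have [_ yb i] := Gx; exists y => //; have [fa _ j] := fP y yb.
    by apply: (@seg_inj a) => //; apply: iso_trans j (iso_sym i).
- exfalso; move/existsNP: Db => [y0 /not_implyP[y0b nGb]].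
  move/existsNP: Da => [x0 /not_implyP[x0a nGa]].
  have [m [ma nGm mmin]] := @cwo_min a (fun x => ~ exists y, G x y) x0 x0a nGa.
  have [n [nb nGn nmin]] := @cwo_min b (fun y => ~ exists x, G x y) y0 y0b nGb.
  apply: (nGm); exists n; split=> //; apply/isofP.
  have /choice[f fP] : forall x, exists y, x \in cwo_dom (cwo_seg a m) -> G x y.
    move=> x; have [/segP[xa xm]|_] := boolP (x \in _); last by exists 0.
    have [y Gx] : exists y, G x y.
      by apply: contrapT => /(mmin _ xa); rewrite (negPf xm).
    by exists y.
  exists f; split=> [x xs|x y /fP+ /fP|y /segP[yb yn]].
  + have Gx := fP x xs; have [_ fb j] := Gx; apply/segP; split=> //.
    apply/negP => mf; apply: (nGn); have [->|nm] := eqVneq n (f x); first by exists x.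
    apply: (Gdown' _ _ _ Gx); apply/segP; split => //.
    by apply: contra nm => fm; apply/eqP; apply: (cwo_anti nb fb).
  + by move=> ? ?; apply/esym/Gle.
  + have [x Gx] : exists x, G x y.
      by apply: contrapT => /(nmin _ yb); rewrite (negPf yn).
    have [xa _ i] := Gx.
    have xs : x \in cwo_dom (cwo_seg a m).
      apply/segP; split=> //; apply/negP => mx.
      have [E|nm] := eqVneq m x; first by apply: (nGm); exists y; rewrite E.
      apply: (nGm); apply: (Gdown _ _ _ Gx); apply/segP; split => //.
      by apply: contra nm => fm; apply/eqP; apply: (cwo_anti ma xa).
    exists x => //; have [_ fb j] := fP x xs.
    by apply: (@seg_inj b) => //; apply: iso_trans (iso_sym j) i.
Qed.

Definition ordinal_of (a : cwo) : omega1 := exist _ (order_type a) (imageT _ _).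

Lemma ordinal_of_surj alpha : exists a, alpha = ordinal_of a.
Proof.
case: alpha => C CP; have [a _ Ca] := CP; exists a.
by apply: eq_exist; rewrite Ca.
Qed.

Lemma ordinal_of_eq a b : ordinal_of a = ordinal_of b <-> cwo_iso a b.
Proof.
split=> [/(congr1 sval)/= E|i]; last first.
  apply: eq_exist; apply/seteqP; split=> c /=; first exact/iso_trans/iso_sym.
  exact: iso_trans.
suff : order_type a b by []. 
by rewrite E; exact: iso_refl.
Qed.

Lemma omega1_ltP a b : omega1_lt (ordinal_of a) (ordinal_of b) <->
  exists2 y, y \in cwo_dom b & cwo_iso a (cwo_seg b y).
Proof.
split=> [[a' [b' [/= aa' bb' [y yb' i]]]]|H]; last first.
  by exists a, b; split=> //; exact: iso_refl.
have /isofP[f jf] := iso_sym bb'; exists (f y); first by case: jf => + _ _; apply.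
by apply: iso_trans (aa') _; apply: iso_trans i _; apply: isof_seg.
Qed.

Lemma omega1_seg_lt a x : x \in cwo_dom a ->
  omega1_lt (ordinal_of (cwo_seg a x)) (ordinal_of a).
Proof. by move=> xa; apply/omega1_ltP; exists x => //; exact: iso_refl. Qed.

Lemma omega1_ltE a alpha : omega1_lt alpha (ordinal_of a) <->
  exists2 x, x \in cwo_dom a & alpha = ordinal_of (cwo_seg a x).
Proof.
have [b ->] := ordinal_of_surj alpha; rewrite omega1_ltP.
by split=> -[x xa] /ordinal_of_eq; exists x.
Qed.

Lemma omega1_lt_irr alpha : ~ omega1_lt alpha alpha.
Proof.
have [a ->] := ordinal_of_surj alpha; move=> /omega1_ltP[y ya].
exact: seg_not_iso.
Qed.

Lemma omega1_lt_trans alpha beta gamma :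
  omega1_lt alpha beta -> omega1_lt beta gamma -> omega1_lt alpha gamma.
Proof.
have [c ->] := ordinal_of_surj gamma => ab /omega1_ltE[x xc bE]; move: ab.
rewrite bE => /omega1_ltE[y yx ->]; apply/omega1_ltP; exists y.
  by have /segP[] := yx.
exact: seg_seg.
Qed.

Lemma omega1_lt_total alpha beta :
  alpha = beta \/ omega1_lt alpha beta \/ omega1_lt beta alpha.
Proof.
have [a aE] := ordinal_of_surj alpha; have [b bE] := ordinal_of_surj beta.
subst alpha beta; have [|[|[x xa /iso_sym i]]] := cwo_compare a b.
- by left; apply/ordinal_of_eq.
- by right; left; apply/omega1_ltP.
- by right; right; apply/omega1_ltP; exists x.
Qed.

Lemma omega1_lt_min (A : omega1 -> Prop) alpha : A alpha ->
  exists2 mu, A mu & forall beta, omega1_lt beta mu -> ~ A beta.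
Proof.
have [a ->] := ordinal_of_surj alpha => Aa.
have [H|] := pselect (forall beta, omega1_lt beta (ordinal_of a) -> ~ A beta).
  by exists (ordinal_of a).
move=> /existsNP[beta /not_implyP[/omega1_ltE[x xa ->] /contrapT Ax]].
have [m [ma Am mmin]] :=
  @cwo_min a (fun x => A (ordinal_of (cwo_seg a x))) x xa Ax.
exists (ordinal_of (cwo_seg a m)) => // _ /omega1_ltE[y ys ->].
have /ordinal_of_eq -> := seg_seg ma ys.
by case/segP: ys => ya my /(mmin _ ya); rewrite (negPf my).
Qed.

Lemma omega1_le_anti alpha beta :
  omega1_le alpha beta -> omega1_le beta alpha -> alpha = beta.
Proof.
move=> /asboolP[//|ab] /asboolP[//|ba].
by case: (omega1_lt_irr (omega1_lt_trans ab ba)).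
Qed.

Lemma omega1_lt_leN alpha beta : omega1_lt alpha beta <-> ~~ omega1_le beta alpha.
Proof.
split=> [ab|/asboolPn].
  apply/asboolPn => -[E|/(omega1_lt_trans ab)]; last exact: omega1_lt_irr.
  by rewrite E in ab; exact: omega1_lt_irr ab.
move=> nle; have [E|[//|ba]] := omega1_lt_total alpha beta.
  by case: nle; left.
by case: nle; right.
Qed.

Theorem omega1_well_order : well_order omega1_le.
Proof.
apply: (@antisymmetric_well_order omega1).
  by move=> x y /andP[xy yx]; exact: omega1_le_anti.
move=> A [x Ax].
have [m Am mmin] := @omega1_lt_min (fun z => z \in A) x Ax; exists m; split=> // y Ay.
by apply: contrapT => /negP/omega1_lt_leN/mmin; apply.
Qed.

Theorem countable_omega1_lt alpha :
  countable [set beta | omega1_lt beta alpha].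
Proof.
have [a ->] := ordinal_of_surj alpha.
apply: (@sub_countable _ _ _
  ((fun x => ordinal_of (cwo_seg a x)) @` [set: nat])).
  by apply: subset_card_le => beta /omega1_ltE[x xa ->]; exists x.
exact: card_image_le.
Qed.

Theorem uncountable_omega1 : ~ countable [set: omega1].
Proof.
move=> /countable_injP[e einj].
have {}einj alpha beta : e alpha = e beta -> alpha = beta.
  by move=> E; apply: einj => //; rewrite in_setT.
pose D : {pred nat} := fun n => `[< range e n >].
pose R : rel nat := fun m n =>
  `[< exists alpha beta, [/\ e alpha = m, e beta = n & omega1_le alpha beta] >].
have Re alpha beta : R (e alpha) (e beta) = omega1_le alpha beta.
  apply/asboolP/idP => [[a [b [/einj -> /einj ->]]]//|H].
  by exists alpha, beta.
have De alpha : e alpha \in D by apply/asboolP; exists alpha.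
have Rwf : wo_chain R D.
  apply: antisymmetric_wo_chain.
    move=> _ _ /asboolP[x _ <-] /asboolP[y _ <-]; rewrite !Re => /andP[xy yx].
    by congr e; exact: omega1_le_anti.
  move=> A sAD [n An]; have /asboolP[x _ xn] := sAD n An.
  have [|m Am mmin] := @omega1_lt_min (fun alpha => e alpha \in A) x.
    by rewrite xn.
  exists (e m); split=> // k Ak; have /asboolP[y _ yk] := sAD k Ak.
  rewrite -yk Re; apply: contrapT => /negP/omega1_lt_leN/mmin; apply.
  by rewrite yk.
pose W := Cwo Rwf; apply: (@seg_not_iso W (e (ordinal_of W)) (De _)).
apply/isofP.
(* [e] transports the isomorphism x |-> [seg W x] of W onto the ordinals
   below [W]. *)
exists (fun x => e (ordinal_of (cwo_seg W x))); split.
- move=> x xW; apply/segP; split; first exact: De.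
  by rewrite /= Re; apply/omega1_lt_leN/omega1_seg_lt.
- have key x y : x \in cwo_dom W -> y \in cwo_dom W -> ~~ cwo_le W x y ->
      omega1_lt (ordinal_of (cwo_seg W y)) (ordinal_of (cwo_seg W x)).
    move=> xW yW xy; have ys : y \in cwo_dom (cwo_seg W x) by apply/segP.
    have /ordinal_of_eq <- := seg_seg xW ys; exact: omega1_seg_lt.
  move=> x y xW yW; rewrite /= Re; apply/idP/idP; last first.
    move=> xy; have [->|nxy] := eqVneq x y; first by apply/asboolP; left.
    apply/asboolP; right; apply: key => //; apply: contra nxy => yx.
    by apply/eqP; apply: (cwo_anti xW yW).
  by apply: contraLR => /(key _ _ xW yW)/omega1_lt_leN.
- move=> y /segP[/asboolP[beta _ <-]]; rewrite /= Re => /omega1_lt_leN.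
  by move=> /omega1_ltE[x xW ->]; exists x.
Qed.

(* Main.v *)
(** Consider formal binary trees whose leaves are pairs (a, s) with a < omega_1
    and s : nat, and let f a enumerate the trees whose leaves have index <= a.
    Each leaf (a, s) is decomposed as the pair f a (2s+1), (a, 2s+1).  This
    pair is also the pair of children of a node, so such nodes
    are decomposed instead as f a (2s), (a, 2s), which keeps the decomposition
    bijective.  Iterating s |-> 2s+1 from any leaf (a, s) visits enough indices
    to produce every tree with leaves of index <= a, and an uncountable
    subalgebra contains leaves of arbitrarily large index. *)
Require Import Defs.
From mathcomp Require Import all_boot.
From mathcomp Require Import all_classical.
From mathcomp Require Import wochoice.

Set Implicit Arguments.
Unset Strict Implicit.
Unset Printing Implicit Defensive.

Local Open Scope classical_set_scope.
Local Open Scope card_scope.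

(** * Injections, bijections and enumerations *)

Lemma card_le_injective (T U : Type) (f : T -> U) :
  injective f -> [set: T] #<= [set: U].
Proof.
move=> finj.
have /inj_card_eq fE : {in [set: T] &, injective f} by move=> x y _ _; exact: finj.
by rewrite -(card_le_eql fE); exact: subset_card_le.
Qed.

Lemma card_eq_bijective (T U : Type) : [set: T] #= [set: U] ->
  exists (h : T -> U) (h' : U -> T), cancel h h' /\ cancel h' h.
Proof.
move=> /card_bijP[h0 [h0' h0K h0'K]].
exists (fun t => val (h0 (SigSub (in_setT t)))).
exists (fun x => val (h0' (SigSub (in_setT x)))).
split=> z.
  by rewrite (_ : SigSub _ = h0 (SigSub (in_setT z))) ?h0K //; exact: val_inj.
by rewrite (_ : SigSub _ = h0' (SigSub (in_setT z))) ?h0'K //; exact: val_inj.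
Qed.

Lemma countable_enumeration (T : Type) (A : set T) (x0 : T) :
  countable A -> A x0 ->
  exists g : nat -> T, (forall n, A (g n)) /\ (forall x, A x -> exists n, g n = x).
Proof.
move=> /countable_injP[e einj] Ax0.
have /choice[g gP] : forall n, exists x, A x /\ forall y, A y -> e y = n -> x = y.
  move=> n; have [[x [Ax <-]]|nx] := pselect (exists x, A x /\ e x = n).
    by exists x; split=> // y Ay /esym; apply: einj; rewrite inE.
  by exists x0; split=> // y Ay yn; case: nx; exists y.
exists g; split=> [n|x Ax]; first by have [] := gP n.
by exists (e x); have [_] := gP (e x); apply.
Qed.

(** * Embedding well-orders with countable initial segments into omega_1 *)

Section Embedding.
Variables (X : Type) (lt : X -> X -> Prop).
Hypothesis lt_trans : forall x y z, lt x y -> lt y z -> lt x z.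
Hypothesis lt_total : forall x y, x = y \/ lt x y \/ lt y x.
Hypothesis lt_min : forall (A : X -> Prop) x, A x ->
  exists2 m, A m & forall y, lt y m -> ~ A y.
Hypothesis lt_countable : forall x, countable [set y | lt y x].

(** Each [x] is sent to the order type of its initial segment, coded on [nat]. For [y] below [x],
    the segment of [y] is isomorphic to a proper initial segment of that of [x], and no well-order
    is isomorphic to a proper initial segment of itself. *)
Lemma omega1_embedding : exists f : X -> omega1, injective f.
Proof.
have /choice[c cP] : forall x, exists c : (X -> nat) * (nat -> X),
    forall y, lt y x -> c.2 (c.1 y) = y.
  move=> x; have /countable_injP[e einj] := lt_countable x.
  have /choice[d dP] : forall n, exists y, forall z, lt z x -> e z = n -> y = z.
    move=> n; have [[y [yx <-]]|ny] := pselect (exists y, lt y x /\ e y = n).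
      by exists y => z zx /esym; apply: einj; rewrite inE.
    by exists x => z zx zn; case: ny; exists z.
  by exists (e, d) => y yx /=; exact: dP.
pose e x := (c x).1; pose d x := (c x).2.
have de x y : lt y x -> d x (e x y) = y by exact: cP.
(* [d x] is arbitrary off the codes of points below [x], so [D x] keeps only the numbers that
   survive the round trip. *)
pose D x : {pred nat} := fun n => `[< lt (d x n) x /\ e x (d x n) = n >].
pose R x : rel nat := fun m n => `[< ~ lt (d x n) (d x m) >].
have DP x n : n \in D x -> lt (d x n) x /\ e x (d x n) = n by move=> /asboolP.
have De x y : lt y x -> e x y \in D x by move=> yx; apply/asboolP; rewrite de.
have Rwf x : wo_chain (R x) (D x).
  apply: antisymmetric_wo_chain => [m n /DP[mx <-] /DP[nx <-]|A sA [n An]].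
    rewrite /R !de // => /andP[/asboolP mn /asboolP nm].
    by have [->|[]] := lt_total (d x m) (d x n).
  have [nx en] := DP x n (sA _ An).
  have [|z [zx ezA] zmin] :=
    @lt_min (fun z => lt z x /\ e x z \in A) (d x n); first by rewrite en.
  exists (e x z); split=> // m Am; have [mx em] := DP x m (sA _ Am).
  by apply/asboolP; rewrite de // => /zmin; apply; rewrite em.
pose W x := Cwo (Rwf x).
have segW x y : lt y x -> cwo_iso (W y) (cwo_seg (W x) (e x y)).
  move=> yx; apply/isofP; exists (fun n => e x (d y n)).
  have dx n : n \in D y -> lt (d y n) x by move=> /DP[ny _]; exact: lt_trans yx.
  split=> [n nD|m n mD nD|n /segP[/DP[nx en]]].
  - apply/segP; split; first exact/De/dx.
    apply/negP => /asboolP; rewrite (de _ _ (dx _ nD)) de //; apply.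
    by have [] := DP _ _ nD.
  - by rewrite /= /R !de //; exact: dx.
  - rewrite /= /R de // => /asboolPn/contrapT ny.
    by exists (e y (d x n)); [exact: De|rewrite de].
exists (fun x => ordinal_of (W x)).
have neqW x y : lt y x -> ~ cwo_iso (W x) (W y).
  move=> yx i; apply: (@seg_not_iso (W x) (e x y)); first exact: De.
  exact: iso_trans i (segW _ _ yx).
move=> x y /ordinal_of_eq i; have [//|[xy|yx]] := lt_total x y.
  by case: (neqW _ _ xy); exact: iso_sym.
by case: (neqW _ _ yx).
Qed.

End Embedding.

(** * The product of omega_1 with the natural numbers *)

Definition below (alpha beta : omega1) := beta = alpha \/ omega1_lt beta alpha.

Lemma countable_below alpha : countable [set beta | below alpha beta].
Proof.
have -> : [set beta | below alpha beta] =
    \bigcup_(b in [set: bool])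
      (if b then [set alpha] else [set beta | omega1_lt beta alpha]).
  apply/seteqP; split=> [beta [->|ba]|beta [[] _]/=].
  - by exists true.
  - by exists false.
  - by left.
  - by right.
apply: bigcup_countable => // -[] _; [exact: countable1|exact: countable_omega1_lt].
Qed.

(** In the lexicographic well-order, the predecessors of [(a, m)] lie in the countable set of pairs
    with first component at most [a]. *)
Lemma omega1_nat_embedding : exists f : omega1 * nat -> omega1, injective f.
Proof.
apply: (@omega1_embedding _
  (fun p q => omega1_lt p.1 q.1 \/ p.1 = q.1 /\ p.2 < q.2)).
- move=> [a m] [b n] [c p] /= -[ab|[-> mn]] [bc|[<- np]].
  + by left; exact: omega1_lt_trans bc.
  + by left.
  + by left.
  + by right; split=> //; exact: ltn_trans np.
- move=> [a m] [b n] /=; have [<-|[ab|ba]] := omega1_lt_total a b.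
  + by case: (ltngtP m n) => [mn|nm|->]; [right; left; right|right; right; right|left].
  + by right; left; left.
  + by right; right; left.
- move=> A [a m] Aam.
  have [b [n Abn] bmin] := @omega1_lt_min (fun b => exists n, A (b, n)) a
    (ex_intro _ m Aam).
  have exn : exists n, `[< A (b, n) >] by exists n; apply/asboolP.
  case: (ex_minnP exn) => k /asboolP Ak kmin; exists (b, k) => // -[c p] /=.
  move=> [cb Ac|[-> pk] Ac]; first by apply: (bmin c cb); exists p.
  by have := kmin p (introT (asboolP _) Ac); rewrite leqNgt pk.
- move=> [a m]; apply: (@sub_countable _ _ _
    ([set b | below a b] `*` [set: nat])).
    by apply: subset_card_le => -[b n] /= [ba|[-> _]]; split=> //; [right|left].
  by apply: countableX => //; exact: countable_below.
Qed.

(** * Binary trees and a bijective pairing on them *)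

Section Trees.
Variable I : Type.

Inductive tree := Leaf of I & nat | Node of tree & tree.

Fixpoint leaves (P : I -> Prop) (t : tree) : Prop :=
  match t with
  | Leaf i _ => P i
  | Node u v => leaves P u /\ leaves P v
  end.

Lemma leaves_sub (P Q : I -> Prop) t :
  (forall i, P i -> Q i) -> leaves P t -> leaves Q t.
Proof.
by move=> PQ; elim: t => [i s|u IHu v IHv] /= => [|[/IHu ? /IHv ?]]; [exact: PQ|].
Qed.

(** An injection of the admissible indices into [nat] turns these trees into finite trees labelled
    by pairs of numbers, of which there are countably many. *)
Lemma countable_leaves (P : I -> Prop) :
  countable [set i | P i] -> countable [set t | leaves P t].
Proof.
move=> /countable_injP[e einj].
pose code := fix code t : GenTree.tree (nat * nat)%type := match t with
  | Leaf i s => GenTree.Leaf (e i, s)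
  | Node u v => GenTree.Node 0 [:: code u; code v] end.
apply/countable_injP; exists (fun t => pickle (code t)) => t t'.
rewrite !inE /= => Pt Pt' /(pcan_inj pickleK).
elim: t t' Pt Pt' => [i s|u IHu v IHv] [j s'|u' v'] //=.
  by move=> Pi Pj [/einj -> //]; [move=> ->|rewrite inE..].
by move=> [Pu Pv] [Pu' Pv'] [/IHu -> // /IHv ->].
Qed.

Variable f : I -> nat -> tree.

(** The special pairs [(f i s, Leaf i s)] are shared as in Hilbert's hotel: odd [s] serves the
    leaves, even [s] the nodes formed from the special pair at [s./2]. *)
Definition tree_mul (u v : tree) : tree :=
  if v is Leaf i s then
    if `[< u = f i s >] then
      if odd s then Leaf i s./2 else Node (f i s./2) (Leaf i s./2)
    else Node u v
  else Node u v.

Definition tree_split (t : tree) : tree * tree :=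
  match t with
  | Leaf i s => (f i s.*2.+1, Leaf i s.*2.+1)
  | Node u v =>
      if v is Leaf i s then
        if `[< u = f i s >] then (f i s.*2, Leaf i s.*2) else (u, v)
      else (u, v)
  end.

Lemma tree_mulK u v : tree_split (tree_mul u v) = (u, v).
Proof.
case: v => [i s|v w] //=; case: asboolP => [->|/asboolPn/negPf ns]; last first.
  by rewrite /= ns.
have := odd_double_half s; case: odd => [<-|<-] /=.
  by rewrite add1n /= uphalf_double.
by rewrite add0n doubleK; case: asboolP.
Qed.

Lemma tree_splitK t : tree_mul (tree_split t).1 (tree_split t).2 = t.
Proof.
case: t => [i s|u [i s|v w]] //=.
  by case: asboolP => //; rewrite odd_double /= uphalf_double.
case: (asboolP (u = f i s)) => [->|/asboolPn/negPf ns] /=; last by rewrite ns.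
by case: asboolP => //; rewrite odd_double doubleK.
Qed.

(** * Trees reachable by splitting *)

Section Subalgebra.
Variable B : set tree.
Hypothesis splitB : forall t, B t -> B (tree_split t).1 /\ B (tree_split t).2.

(** Splitting a leaf replaces [s] by [2s+1], that is, doubles [s+1]. The value of [f] produced along
    with it carries the index of the next round. *)
Lemma leaf_pow2 i s n : B (Leaf i s) ->
  B (Leaf i (s.+1 * 2 ^ n).-1) /\ B (f i (s.+1 * 2 ^ n.+1).-1).
Proof.
move=> Bs.
have step m : (s.+1 * 2 ^ m.+1).-1 = (s.+1 * 2 ^ m).-1.*2.+1.
  have : 0 < s.+1 * 2 ^ m by rewrite muln_gt0 expn_gt0.
  rewrite expnSr mulnA muln2; by case: (s.+1 * 2 ^ m).
have Bn : B (Leaf i (s.+1 * 2 ^ n).-1).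
  elim: n => [|n /splitB[_]]; first by rewrite muln1.
  by rewrite /= -step.
by split=> //; have [+ _] := splitB Bn; rewrite /= -step.
Qed.

(** Induction on [t]: a node that splits into its children passes the violation of [P] to one of
    them. Any other node is [Node (f i s) (Leaf i s)]; its split contains a leaf of index [i], and
    [P i] would force [P] on the whole node. *)
Lemma reach_leaf (P : I -> Prop) t :
  (forall i s, P i -> leaves P (f i s)) -> B t -> ~ leaves P t ->
  exists i s, B (Leaf i s) /\ ~ P i.
Proof.
move=> Pf; elim: t => [i s|u IHu v IHv] Bt nP; first by exists i, s.
have [E|E] := pselect (tree_split (Node u v) = (u, v)).
  have := splitB Bt; rewrite E => -[/IHu{}IHu /IHv{}IHv].
  have [Pu|//] := pselect (leaves P u); apply: IHv => Pv; exact: nP.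
have {E} : exists i s, v = Leaf i s /\ u = f i s.
  by case: v {IHv Bt nP} E => [i s|//] /=; case: asboolP => // ->; exists i, s.
move=> [i [s [vE uE]]]; subst u v.
exists i, s.*2; split; first by have [_] := splitB Bt; rewrite /=; case: asboolP.
by move=> Pi; apply: nP; split=> //; exact: Pf.
Qed.

End Subalgebra.
End Trees.

Arguments Leaf {I}.
Arguments Node {I}.

(** With [v] the 2-adic valuation of [s+1], the inner valuation is [v + n + 1] and takes every value
    above [v]. One of these is [3 ^ k * 2 ^ v], where the factor [2 ^ v] secures the size without
    changing the 3-adic valuation. *)
Lemma logn3_logn2_surj s k : exists n, logn 3 (logn 2 (s.+1 * 2 ^ n.+1)) = k.
Proof.
pose v := logn 2 s.+1.
have lt : v < 3 ^ k * 2 ^ v.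
  by apply: leq_trans (ltn_expl v (isT : 1 < 2)) _; rewrite leq_pmull // expn_gt0.
exists (3 ^ k * 2 ^ v - v.+1); rewrite subnSK // lognM ?expn_gt0 //.
rewrite pfactorK // subnKC ?(ltnW lt) // lognM ?expn_gt0 // pfactorK //.
by rewrite lognX (lognE 3 2) /= muln0 addn0.
Qed.

(** * Transport along a bijection, and closure of subalgebras *)

Lemma jonsson_tarski_transfer (T U : Type) (mul : T -> T -> T) (l r : T -> T)
    (h : T -> U) (h' : U -> T) : cancel h h' -> cancel h' h ->
  jonsson_tarski mul l r ->
  jonsson_tarski (fun x y => h (mul (h' x) (h' y)))
    (fun x => h (l (h' x))) (fun x => h (r (h' x))).
Proof.
move=> hK h'K [lm rm mlr].
by split=> [x y|x y|z]; rewrite !hK ?lm ?rm ?mlr h'K.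
Qed.

Lemma subalgebra_jtP (A : Type) (mul : A -> A -> A) (l r : A -> A) (B : set A) :
  subalgebra (jt_algebra mul l r) B ->
  [/\ forall x y, B x -> B y -> B (mul x y), forall x, B x -> B (l x) &
      forall x, B x -> B (r x)].
Proof.
move=> sB; split=> [x y Bx By|x Bx|x Bx].
- have := sB JTmul [tuple x; y]; apply => -[[|[|//]] lti] /=.
    by rewrite (tnth_nth x).
  by rewrite (tnth_nth x).
- have := sB JTl [tuple x]; rewrite /= theadE; apply => i.
  by rewrite ord1 (tnth_nth x).
- have := sB JTr [tuple x]; rewrite /= theadE; apply => i.
  by rewrite ord1 (tnth_nth x).
Qed.

(** * Bounds on leaves and the cardinality of the set of trees *)

Lemma below_trans alpha beta gamma :
  below alpha beta -> below beta gamma -> below alpha gamma.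
Proof.
move=> [->//|ba] [->|cb]; first by right.
by right; exact: omega1_lt_trans ba.
Qed.

Lemma leaves_bounded (t : tree omega1) : exists alpha, leaves (below alpha) t.
Proof.
elim: t => [alpha s|u [a ua] v [b vb]]; first by exists alpha; left.
wlog ab : a b u v ua vb / below b a.
  move=> IH; have [E|[ab|ba]] := omega1_lt_total a b.
  - by apply: (IH a b) => //; left.
  - by apply: (IH a b) => //; right.
  - have [|c [cv cu]] := IH b a v u vb ua; first by right.
    by exists c.
by exists b; split=> //; apply: leaves_sub ua => c; exact: below_trans.
Qed.

Lemma countable_leaves_below alpha : countable [set t | leaves (below alpha) t].
Proof. exact/countable_leaves/countable_below. Qed.

(** A tree is determined by a bound of its leaves together with its code among the countably many
    trees with that bound; this injects the trees into [omega1 * nat]. *)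
Lemma card_tree_omega1 : [set: tree omega1] #= [set: omega1].
Proof.
apply/card_eqPle; split; last first.
  by apply: (@card_le_injective _ _ (fun a => Leaf a 0)) => a b [].
have [f finj] := omega1_nat_embedding.
have [b bP] := choice leaves_bounded.
have /choice[e einj] : forall alpha, exists e : tree omega1 -> nat,
    {in [set t | leaves (below alpha) t] &, injective e}.
  by move=> alpha; exact/countable_injP/countable_leaves_below.
apply: (@card_le_injective _ _ (fun t => f (b t, e (b t) t))) => t u /finj[bE].
by rewrite bE; apply: einj; rewrite inE //= -bE.
Qed.

Theorem theorem4p2 :
  exists (mul : omega1 -> omega1 -> omega1) (l r : omega1 -> omega1),
    jonsson_tarski mul l r /\ jonsson_algebra (jt_algebra mul l r).
Proof.
have /choice[g gP] : forall alpha, exists g : nat -> tree omega1,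
    (forall n, leaves (below alpha) (g n)) /\
    (forall t, leaves (below alpha) t -> exists n, g n = t).
  move=> alpha; apply: (@countable_enumeration _ _ (Leaf alpha 0)).
    exact: countable_leaves_below.
  by left.
(* The double valuation takes every value along the orbit of any [s] under [s |-> 2s+1], so each
   leaf of index [alpha] leads to all of [g alpha]. *)
pose f alpha s := g alpha (logn 3 (logn 2 s.+1)).
have fP alpha beta s : below alpha beta -> leaves (below alpha) (f beta s).
  move=> ba; apply: leaves_sub (_ : leaves (below beta) _) => [c|].
    exact: below_trans.
  by have [+ _] := gP beta; apply.
have jtT : jonsson_tarski (tree_mul f) (fun t => (tree_split f t).1)
    (fun t => (tree_split f t).2).
  by split=> [x y|x y|z]; rewrite ?tree_mulK ?tree_splitK.
have [h [h' [hK h'K]]] := card_eq_bijective card_tree_omega1.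
exists (fun x y => h (tree_mul f (h' x) (h' y))).
exists (fun x => h (tree_split f (h' x)).1).
exists (fun x => h (tree_split f (h' x)).2).
split; first exact: jonsson_tarski_transfer hK h'K jtT.
split.
- apply/countable_injP.
  exists (fun o => match o with JTmul => 0 | JTl => 1 | JTr => 2 end).
  by move=> [] [].
- by move=> /finite_set_countable; exact: uncountable_omega1.
move=> [C [/subalgebra_jtP[mulC lC rC] [_ nsub] cardC]]; apply: nsub => x _.
(* The subalgebra [C] is read as a set of trees; it remains to show that it contains the arbitrary
   point [x]. *)
pose B : set (tree omega1) := [set t | C (h t)].
have splitB t : B t -> B (tree_split f t).1 /\ B (tree_split f t).2.
  by rewrite /B /= => Bt; have := lC _ Bt; have := rC _ Bt; rewrite hK.
have uncB : ~ countable B.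
  move=> cB; apply: uncountable_omega1; rewrite -(eq_countable cardC).
  apply: (@sub_countable _ _ _ (h @` B)).
    by apply: subset_card_le => y Cy; exists (h' y); rewrite ?/B /= h'K.
  exact: sub_countable (card_image_le _ _) cB.
have [alpha xa] := leaves_bounded (h' x).
(* Only countably many trees are bounded by [alpha], so the uncountable [B] contains an unbounded
   one, and hence a leaf whose index [b] exceeds [alpha]. *)
have [t [Bt nt]] : exists t, B t /\ ~ leaves (below alpha) t.
  apply: contrapT => nt; apply: uncB.
  apply: sub_countable (countable_leaves_below alpha); apply: subset_card_le => t Bt.
  by apply: contrapT => nb; apply: nt; exists t.
have [b [s [Bb nb]]] := reach_leaf splitB (fP alpha) Bt nt.
have ab : below b alpha.
  have [->|[ab|ba]] := omega1_lt_total alpha b; [by left|by right|].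
  by case: nb; right.
(* The leaves of [h' x] are also bounded by [b], so it is [g b k] for some [k], and the orbit of the
   leaf [(b, s)] reaches an index with double valuation [k]. *)
have [_ /(_ (h' x))[|k gk]] := gP b.
  by apply: leaves_sub xa => c; exact: below_trans.
have [n nk] := logn3_logn2_surj s k.
have [_] := leaf_pow2 splitB n Bb.
by rewrite /f prednK ?muln_gt0 ?expn_gt0 // nk gk /B /= h'K.
Qed.
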